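(* Let $f:(G,\tau)\to(H,\sigma)$ be a continuous surjective homomorphism of topological groups, let $q:G\to G/\ker f$ be the canonical projection, let $\tau_q$ be the quotient topology of $\tau$ on $G/\ker f$, and let $f':(G/\ker f,\tau_q)\to(H,\sigma)$ be the continuous isomorphism defined by $f'(q(g))=f(g)$ for every $g\in G$. Then the following are equivalent: (a) $f$ is A-open; (b) $f'$ is semitopological.
   Context: Topological groups are not assumed Hausdorff. A continuous isomorphism is a bijective continuous homomorphism (its inverse need not be continuous). $\mathcal V_{(G,\tau)}(e_G)$ is the filter of all neighborhoods of $e_G$ in $(G,\tau)$. For a neighborhood $U$ of $e_G$, a subset $M\subseteq G$ is $U$-thin if $\bigcap\{x^{-1}Ux:x\in M\}$ is a neighborhood of $e_G$. Write $[x,y]=xyx^{-1}y^{-1}$ and, for $g\in G$ and $K\subseteq G$, $[g,K]=\{[g,k]:k\in K\}$. A homomorphism $f:(G,\tau)\to(H,\sigma)$ is A-open if for every $U\in\mathcal V_{(G,\tau)}(e_G)$: (a) there exists $V\in\mathcal V_{(H,\sigma)}(e_H)$ such that $f^{-1}(V)$ is $f^{-1}(f(U))$-thin; (b) for every $g\in G$ there exists $V_g\in\mathcal V_{(H,\sigma)}(e_H)$ such that $[g,f^{-1}(V_g)]\subseteq f^{-1}(f(U))$. A continuous surjective homomorphism $f:(G,\tau)\to(H,\sigma)$ is semitopological if there exist a topological group $(\widetilde G,\widetilde\tau)$ containing $G$ as a topological normal subgroup (i.e. $G$ is, up to identification, a normal subgroup of $\widetilde G$ and $\widetilde\tau\restriction_G=\tau$)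 and an open continuous homomorphism $\widetilde f:(\widetilde G,\widetilde\tau)\to(H,\sigma)$ extending $f$. *)

(* Defs.v *)
From HB Require Import structures.
From mathcomp Require Import all_boot all_classical topology.

Set Implicit Arguments.
Unset Strict Implicit.
Unset Printing Implicit Defensive.

Local Open Scope classical_set_scope.
Local Open Scope group_scope.
Local Open Scope quotient_scope.

HB.mixin Record isTopologicalGroup G & Topological G & Group G := {
  mulg_continuous : continuous (fun x : G * G => x.1 * x.2);
  invg_continuous : continuous (fun x : G => x^-1)
}.

(* No separation axiom is required. *)
#[short(type="topologicalGroupType")]
HB.structure Definition TopologicalGroup :=
  {G of Topological G & Group G & isTopologicalGroup G}.

Lemma mulgl_continuous (G : topologicalGroupType) (a : G) :
  continuous (fun x : G => a * x).
Proof.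
move=> x; apply: (@continuous_comp _ _ _ (fun x => (a, x)) (fun x => x.1 * x.2)).
  by apply: cvg_pair; [exact: cvg_cst | exact: cvg_id].
exact: mulg_continuous.
Qed.

Lemma mulgr_continuous (G : topologicalGroupType) (a : G) :
  continuous (fun x : G => x * a).
Proof.
move=> x; apply: (@continuous_comp _ _ _ (fun x => (x, a)) (fun x => x.1 * x.2)).
  by apply: cvg_pair; [exact: cvg_id | exact: cvg_cst].
exact: mulg_continuous.
Qed.

Record is_normal_subgroup (G : groupType) (N : set G) : Prop := IsNormalSubgroup {
  normal1 : N 1;
  normalM : forall x y, N x -> N y -> N (x * y);
  normalV : forall x, N x -> N x^-1;
  normalJ : forall x y, N x -> N (x ^ y)
}.

Record normalSubgroup (G : groupType) := NormalSubgroup {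
  normal_set : set G;
  normalP : is_normal_subgroup normal_set
}.

Section QuotientGroup.
Variables (G : groupType) (N : normalSubgroup G).

Definition coset_rel : rel G := fun x y => `[< normal_set N (x^-1 * y) >].

Lemma coset_rel_refl : reflexive coset_rel.
Proof. by move=> x; apply/asboolP; rewrite mulVg; exact: (normal1 (normalP N)). Qed.

Lemma coset_rel_sym : symmetric coset_rel.
Proof.
suff h x y : coset_rel x y -> coset_rel y x by move=> x y; apply/idP/idP; exact: h.
move=> /asboolP /(normalV (normalP N)) h; apply/asboolP.
by rewrite invgM invgK in h.
Qed.

Lemma coset_rel_trans : transitive coset_rel.
Proof.
move=> y x z /asboolP xy /asboolP yz; apply/asboolP.
by have := normalM (normalP N) xy yz; rewrite -mulgA mulVKg.
Qed.

Canonical coset_equiv :=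
  EquivRel coset_rel coset_rel_refl coset_rel_sym coset_rel_trans.

End QuotientGroup.

(* [quotient_topology] is the final topology of the projection [\pi]. *)
Definition quotient_group (G : topologicalGroupType) (N : normalSubgroup G) : Type :=
  quotient_topology {eq_quot coset_equiv N}.

Section QuotientTopologicalGroup.
Variables (G : topologicalGroupType) (N : normalSubgroup G).
Local Notation Q := (quotient_group N).

HB.instance Definition _ := Topological.copy Q (quotient_topology {eq_quot coset_equiv N}).
HB.instance Definition _ := Quotient.copy Q (quotient_topology {eq_quot coset_equiv N}).

Definition quotient_proj (x : G) : Q := \pi_Q x.

Lemma quotient_projP (x y : G) : quotient_proj x = quotient_proj y <-> normal_set N (x^-1 * y).
Proof.
split=> [xy|xy].
  by have /eqmodP/asboolP : x = y %[mod {eq_quot coset_equiv N}] by exact: xy.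
have : x = y %[mod {eq_quot coset_equiv N}] by apply/eqmodP/asboolP.
exact.
Qed.

Lemma quotient_proj_surj (u : Q) : exists x, quotient_proj x = u.
Proof. by exists (repr u); exact: reprK. Qed.

Definition quotient_one : Q := quotient_proj 1.
Definition quotient_mul (u v : Q) : Q := quotient_proj (repr u * repr v).
Definition quotient_inv (u : Q) : Q := quotient_proj (repr u)^-1.

Lemma repr_proj x : normal_set N ((repr (quotient_proj x))^-1 * x).
Proof. by apply/quotient_projP; exact: reprK. Qed.

Lemma quotient_mulE x y :
  quotient_mul (quotient_proj x) (quotient_proj y) = quotient_proj (x * y).
Proof.
apply/quotient_projP; set a := repr _; set b := repr _.
have Na : normal_set N (a^-1 * x) by exact: repr_proj.
have Nb : normal_set N (b^-1 * y) by exact: repr_proj.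
have := normalM (normalP N) Nb (normalJ (normalP N) y Na).
by rewrite /conjg !mulgA mulgK invgM.
Qed.

Lemma quotient_invE x : quotient_inv (quotient_proj x) = quotient_proj x^-1.
Proof.
apply/quotient_projP; set a := repr _.
have /(normalV (normalP N)) : normal_set N (a^-1 * x) by exact: repr_proj.
move=> /(normalJ (normalP N) x^-1).
by rewrite /conjg invgM !invgK !mulgA mulgV mul1g.
Qed.

Lemma quotient_mulA : associative quotient_mul.
Proof.
move=> u v w.
have [x <-] := quotient_proj_surj u; have [y <-] := quotient_proj_surj v.
have [z <-] := quotient_proj_surj w.
by rewrite !quotient_mulE mulgA.
Qed.

Lemma quotient_mul1 : left_id quotient_one quotient_mul.
Proof. by move=> u; have [x <-] := quotient_proj_surj u; rewrite quotient_mulE mul1g. Qed.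

Lemma quotient_mulr1 : right_id quotient_one quotient_mul.
Proof. by move=> u; have [x <-] := quotient_proj_surj u; rewrite quotient_mulE mulg1. Qed.

Lemma quotient_mulV : left_inverse quotient_one quotient_inv quotient_mul.
Proof.
move=> u; have [x <-] := quotient_proj_surj u.
by rewrite quotient_invE quotient_mulE mulVg.
Qed.

Lemma quotient_mulrV : right_inverse quotient_one quotient_inv quotient_mul.
Proof.
move=> u; have [x <-] := quotient_proj_surj u.
by rewrite quotient_invE quotient_mulE mulgV.
Qed.

HB.instance Definition _ := isGroup.Build Q quotient_mulA quotient_mul1 quotient_mulr1
  quotient_mulV quotient_mulrV.

Lemma quotient_projM : {morph quotient_proj : x y / x * y}.
Proof. by move=> x y; rewrite -quotient_mulE. Qed.

HB.instance Definition _ := isMultiplicative.Build G Q quotient_proj quotient_projM.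

Lemma quotient_openE (A : set Q) : open A = open (quotient_proj @^-1` A).
Proof. by []. Qed.

Lemma quotient_proj_continuous : continuous quotient_proj.
Proof. by apply/continuousP => A; rewrite quotient_openE. Qed.

Lemma quotient_proj_open (A : set G) : open A -> open (quotient_proj @` A).
Proof.
move=> oA; rewrite quotient_openE.
rewrite (_ : _ @^-1` _ = \bigcup_(n in normal_set N) ((fun x => x * n) @^-1` A)).
  by apply: bigcup_open => n _; have /continuousP := @mulgr_continuous G n; apply.
apply/seteqP; split=> [x [a Aa /esym/quotient_projP Nxa]|x [n Nn Axn]].
  by exists (x^-1 * a) => //=; rewrite mulVKg.
exists (x * n) => //; apply/esym/quotient_projP.
by rewrite mulKg.
Qed.

Lemma quotient_mul_continuous : continuous (fun x : Q * Q => x.1 * x.2).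
Proof.
move=> [u v].
have [x <-] := quotient_proj_surj u; have [y <-] := quotient_proj_surj v.
move=> A /= /[!nbhs_simpl]; rewrite -quotient_projM => pA.
have : nbhs (x * y) (quotient_proj @^-1` A) by exact: quotient_proj_continuous.
move=> /(@mulg_continuous G (x, y)) [[B C] /= [nB nC] BC].
have proj_nbhs z (D : set G) : nbhs z D -> nbhs (quotient_proj z) (quotient_proj @` D).
  rewrite nbhsE => -[E [oE Ez] ED]; rewrite nbhsE.
  exists (quotient_proj @` E); last exact: image_subset.
  by split; [exact: quotient_proj_open | exists z].
exists (quotient_proj @` B, quotient_proj @` C) => /=.
  by split; exact: proj_nbhs.
move=> [_ _] /= [[b Bb <-] [c Cc <-]]; rewrite -quotient_projM.
exact: (BC (b, c)).
Qed.

Lemma quotient_inv_continuous : continuous (fun x : Q => x^-1).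
Proof.
apply/continuousP => A; rewrite !quotient_openE => oA.
rewrite (_ : _ @^-1` _ = (fun x => x^-1) @^-1` (quotient_proj @^-1` A)).
  by have /continuousP := @invg_continuous G; apply.
by apply/seteqP; split=> x /=; rewrite -quotient_invE.
Qed.

HB.instance Definition _ :=
  isTopologicalGroup.Build Q quotient_mul_continuous quotient_inv_continuous.

End QuotientTopologicalGroup.

Section Kernel.
Variables (G H : groupType) (f : {multiplicative G -> H}).

Definition kernel_set : set G := [set x | f x = 1].

Lemma kernel_set_normal : is_normal_subgroup kernel_set.
Proof.
have f1 : f 1 = 1 by apply: (mulgI (f 1)); rewrite -gmulfM !mulg1.
have fV x : f x^-1 = (f x)^-1 by apply: (mulgI (f x)); rewrite -gmulfM !mulgV f1.
rewrite /kernel_set; split=> [|x y|x|x y] //=.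
- by rewrite gmulfM => -> ->; rewrite mulg1.
- by rewrite fV => ->; rewrite invg1.
- by rewrite /conjg !gmulfM fV => ->; rewrite mul1g mulVg.
Qed.

Definition kernel : normalSubgroup G := NormalSubgroup kernel_set_normal.

End Kernel.

(* The map induced by f on G / ker f. *)
Section InducedMap.
Variables (G H : topologicalGroupType) (f : {multiplicative G -> H}).
Local Notation Q := (quotient_group (kernel f)).

Definition kernel_lift (u : Q) : H := f (repr u).

Lemma kernel_liftE x : kernel_lift (quotient_proj (kernel f) x) = f x.
Proof.
have := @repr_proj G (kernel f) x; rewrite /kernel_lift /= /kernel_set /=.
by set a := repr _ => h; rewrite -[in RHS](mulVKg a x) gmulfM h mulg1.
Qed.

Lemma kernel_liftM : {morph kernel_lift : u v / u * v}.
Proof.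
move=> u v.
have [x <-] := quotient_proj_surj u; have [y <-] := quotient_proj_surj v.
by rewrite -quotient_projM !kernel_liftE gmulfM.
Qed.

HB.instance Definition _ := isMultiplicative.Build Q H kernel_lift kernel_liftM.

Lemma kernel_lift_continuous : continuous f -> continuous kernel_lift.
Proof.
move=> /continuousP fc; apply/continuousP => A oA; rewrite quotient_openE.
rewrite (_ : _ @^-1` _ = f @^-1` A); first exact: fc.
by apply/seteqP; split=> x /=; rewrite kernel_liftE.
Qed.

Lemma kernel_lift_inj : injective kernel_lift.
Proof.
move=> u v.
have [x <-] := quotient_proj_surj u; have [y <-] := quotient_proj_surj v.
rewrite !kernel_liftE => fxy; apply/quotient_projP => /=.
apply: (mulgI (f x)).
by rewrite -gmulfM mulVKg mulg1 fxy.
Qed.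

Lemma kernel_lift_surj :
  (forall y, exists x, f x = y) -> forall y, exists u, kernel_lift u = y.
Proof. by move=> fs y; have [x <-] := fs y; exists (quotient_proj _ x); exact: kernel_liftE. Qed.

End InducedMap.

(* [u ^ x] is [x^-1 * (u * x)]. *)
Definition thin (G : topologicalGroupType) (U M : set G) : Prop :=
  nbhs (1 : G) (\bigcap_(x in M) [set u ^ x | u in U]).

(* The library's [[~ x, y]] is x^-1 y^-1 x y. *)
Definition commutator (G : groupType) (x y : G) : G := x * y * x^-1 * y^-1.

Definition A_open (G H : topologicalGroupType) (f : {multiplicative G -> H}) : Prop :=
  forall U : set G, nbhs (1 : G) U ->
    (exists2 V : set H, nbhs (1 : H) V & thin (f @^-1` (f @` U)) (f @^-1` V)) /\
    (forall g : G, exists2 V : set H, nbhs (1 : H) V &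
       [set commutator g k | k in f @^-1` V] `<=` f @^-1` (f @` U)).

Definition topological_embedding (S T : topologicalType) (i : S -> T) : Prop :=
  injective i /\
  forall A : set S, open A <-> exists2 B : set T, open B & i @^-1` B = A.

Definition open_map (S T : topologicalType) (h : S -> T) : Prop :=
  forall A : set S, open A -> open (h @` A).

(* The identification of G with a normal topological subgroup of G' is the
   embedding [i]. *)
Definition semitopological (G H : topologicalGroupType)
    (f : {multiplicative G -> H}) : Prop :=
  [/\ continuous f,
      forall y, exists x, f x = y &
      exists (G' : topologicalGroupType) (i : {multiplicative G -> G'})
             (fext : {multiplicative G' -> H}),
        [/\ topological_embedding i,
            is_normal_subgroup (range i),
            continuous fext,
            open_map fext &
            forall x, fext (i x) = f x]].

(* Main.v *)
From HB Require Import structures.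
Require Import Defs.
From mathcomp Require Import all_boot all_classical topology.

Set Implicit Arguments.
Unset Strict Implicit.
Unset Printing Implicit Defensive.

Local Open Scope classical_set_scope.
Local Open Scope group_scope.

(** Write Q for G / ker f. The projection q is open, and f' is a continuous bijective
    homomorphism, so the proof has two independent halves.

    - [A_open_comp]: A-openness does not see composition with an open continuous
      surjection. Both clauses of the definition speak about saturated sets
      f^-1 (f U), and these correspond to f'^-1 (f' (q U)) along q.

    - For a continuous bijective f', A-open and semitopological are equivalent.

      If f' extends to an open continuous F on a group G' having Q as a normal
      subgroup, then Q and ker F are normal with trivial intersection, so they commute
      elementwise, and G' = Q (ker F). Modulo ker F, which centralizes Q, an element
      of Q over a point near 1 in H can be replaced by an element of G' near 1, for
      which the clauses express continuity of conjugation in G'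
      ([semitopological_A_open]).

      Conversely, H acts on Q by conjugation through the inverse of f', and A-openness
      makes this action jointly continuous ([conj_act_continuous]). The semidirect
      product of Q by H with the product topology is then a topological group
      containing Q as a normal topological subgroup, and (u, h) |-> f'(u) h is an open
      continuous homomorphism extending f' ([A_open_semitopological]). *)

(** * Homomorphisms, limits and neighbourhoods *)

Lemma multiplicative1 (G H : groupType) (f : {multiplicative G -> H}) : f 1 = 1.
Proof. by apply: (mulgI (f 1)); rewrite -gmulfM !mulg1. Qed.

Lemma multiplicativeV (G H : groupType) (f : {multiplicative G -> H}) x :
  f x^-1 = (f x)^-1.
Proof. by apply: (mulgI (f x)); rewrite -gmulfM !mulgV multiplicative1. Qed.

Lemma multiplicativeJ (G H : groupType) (f : {multiplicative G -> H}) x y :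
  f (x ^ y) = f x ^ f y.
Proof. by rewrite /conjg !gmulfM multiplicativeV. Qed.

Lemma multiplicative_commutator (G H : groupType) (f : {multiplicative G -> H}) x y :
  f (commutator x y) = commutator (f x) (f y).
Proof. by rewrite /commutator !gmulfM !multiplicativeV. Qed.

Lemma fst_continuous (S T : topologicalType) : continuous (@fst S T).
Proof. by move=> [x y]; exact: cvg_fst. Qed.

Lemma snd_continuous (S T : topologicalType) : continuous (@snd S T).
Proof. by move=> [x y]; exact: cvg_snd. Qed.

Section Limits.
Variables (G : topologicalGroupType).

Lemma cvg_mulg (T : Type) (F : set_system T) (FF : Filter F) (u v : T -> G) a b :
  u @ F --> a -> v @ F --> b -> (fun t => u t * v t) @ F --> a * b.
Proof.
move=> ua vb; apply: (@continuous2_cvg T G G G F FF u v (fun x y => x * y)) => //.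
exact: (@mulg_continuous G (a, b)).
Qed.

Lemma cvg_invg (T : Type) (F : set_system T) (FF : Filter F) (u : T -> G) a :
  u @ F --> a -> (fun t => (u t)^-1) @ F --> a^-1.
Proof. by move=> ua; apply: cvg_comp ua _; exact: invg_continuous. Qed.

End Limits.

(** Membership in an intersection of conjugates [U ^ x] becomes a condition on the
    conjugates of the point, which homomorphisms preserve. *)
Lemma thinE (G : topologicalGroupType) (U M : set G) :
  thin U M <-> nbhs (1 : G) [set t | forall x, M x -> U (t ^ x^-1)].
Proof.
rewrite /thin; split; apply: filterS => t tU x Mx.
- by have [u Uu <-] := tU x Mx; rewrite conjgK.
- by exists (t ^ x^-1); [exact: tU | rewrite conjgKV].
Qed.

Lemma open_map_nbhs (S T : topologicalType) (h : S -> T) x (A : set S) :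
  open_map h -> nbhs x A -> nbhs (h x) (h @` A).
Proof.
move=> ho; rewrite !nbhsE => -[B [oB Bx] BA].
by exists (h @` B); [split; [exact: ho | exists x] | exact: image_subset].
Qed.

Lemma embedding_nbhs (S T : topologicalType) (i : S -> T) x (A : set S) :
  topological_embedding i -> nbhs x A ->
  exists2 B : set T, nbhs (i x) B & i @^-1` B `<=` A.
Proof.
move=> [_ iE]; rewrite nbhsE => -[C [/iE[B oB BC] Cx] CA].
by exists B; [apply: open_nbhs_nbhs; split=> //; rewrite -BC in Cx | rewrite BC].
Qed.

Lemma embedding_continuous (S T : topologicalType) (i : S -> T) :
  topological_embedding i -> continuous i.
Proof. by move=> [_ iE]; apply/continuousP => B oB; apply/iE; exists B. Qed.

(** * Invariance of A-openness under open surjections *)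

(** Neighbourhoods of 1 are pulled back along [q] by continuity and pushed forward by
    openness; [satE] in each direction compares the two kinds of saturated sets. *)
Lemma A_open_comp (G Q H : topologicalGroupType) (q : {multiplicative G -> Q})
    (f' : {multiplicative Q -> H}) (f : {multiplicative G -> H}) :
  continuous q -> open_map q -> (forall u, exists x, q x = u) ->
  (forall x, f' (q x) = f x) -> A_open f <-> A_open f'.
Proof.
move=> qc qo qs f'E; split=> [Af W W1|Af' U U1].
- have U1 : nbhs (1 : G) (q @^-1` W) by apply: qc; rewrite multiplicative1.
  have satE x : (f @^-1` (f @` (q @^-1` W))) x -> (f' @^-1` (f' @` W)) (q x).
    by move=> [y Wy yx]; exists (q y); rewrite //= !f'E.
  have [[V V1 /thinE Vthin] Vcomm] := Af _ U1; split.
    exists V => //; apply/thinE; have := open_map_nbhs qo Vthin.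
    rewrite multiplicative1; apply: filterS => _ [t tV <-] y Vy.
    have [x xy] := qs y; rewrite -xy -multiplicativeV -multiplicativeJ.
    by apply: satE; apply: tV; rewrite /= -f'E xy.
  move=> y; have [g <-] := qs y; have [Vg Vg1 sVg] := Vcomm g.
  exists Vg => // _ [k Vk <-]; have [x xk] := qs k.
  rewrite -xk -multiplicative_commutator; apply: satE; apply: sVg.
  by exists x; rewrite //= -f'E xk.
- have W1 : nbhs (1 : Q) (q @` U) by rewrite -(multiplicative1 q); exact: open_map_nbhs.
  have satE x : (f' @^-1` (f' @` (q @` U))) (q x) -> (f @^-1` (f @` U)) x.
    by move=> [_ [y Uy <-]]; rewrite !f'E => yx; exists y.
  have [[V V1 /thinE Vthin] Vcomm] := Af' _ W1; split.
    exists V => //; apply/thinE.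
    have : nbhs (1 : G) (q @^-1` [set t | forall x, (f' @^-1` V) x ->
        (f' @^-1` (f' @` (q @` U))) (t ^ x^-1)]) by apply: qc; rewrite multiplicative1.
    apply: filterS => t tV x Vx; apply: satE.
    by rewrite multiplicativeJ multiplicativeV; apply: tV; rewrite /= f'E.
  move=> g; have [Vg Vg1 sVg] := Vcomm (q g).
  exists Vg => // _ [k Vk <-]; apply: satE; rewrite multiplicative_commutator.
  by apply: sVg; exists (q k); rewrite //= f'E.
Qed.

(** * Semitopological isomorphisms are A-open *)

(** The commutator of [x] and [y] lies in both subgroups. *)
Lemma normal_disjoint_commute (G : groupType) (M N : set G) :
  is_normal_subgroup M -> is_normal_subgroup N ->
  (forall x, M x -> N x -> x = 1) ->
  forall x y, M x -> N y -> commute x y.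
Proof.
move=> nM nN MN1 x y Mx Ny.
have : (y * x)^-1 * (x * y) = 1.
  apply: MN1.
  - rewrite invgM -!mulgA; apply: normalM (normalV nM Mx) _ => //.
    by have := normalJ nM y Mx; rewrite /conjg.
  - rewrite invgM mulgA; apply: normalM => //.
    have := normalJ nN x (normalV nN Ny).
    by rewrite /conjg mulgA.
by move=> h; rewrite /commute -[LHS](mulVKg (y * x)) h mulg1.
Qed.

(** If f(x) lies in F(D), then i(x) = w k^-1 with w in D and k in ker F.
    Since k commutes with i(G), conjugating by i(x), or taking a commutator with it,
    gives the same result as with w, so it is small as soon as D is. *)
Lemma semitopological_A_open (G H : topologicalGroupType) (f : {multiplicative G -> H}) :
  injective f -> semitopological f -> A_open f.
Proof.
move=> finj [fc fs [G' [i [F [iemb iN Fc Fo Fi]]]]] U U1.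
have comm x k : F k = 1 -> commute (i x) k.
  move=> Fk; apply: (normal_disjoint_commute iN (kernel_set_normal F)) => //.
  move=> _ [z _ <-]; rewrite /kernel_set /= Fi => fz.
  by have -> : z = 1 by [apply: finj; rewrite multiplicative1]; rewrite multiplicative1.
have nbhsi (A : set G') : nbhs (1 : G') A -> nbhs (1 : H) (F @` A).
  by move=> A1; rewrite -(multiplicative1 F); exact: open_map_nbhs.
have factor w x : F w = f x -> exists2 k, F k = 1 & w = i x * k.
  move=> wx; exists ((i x)^-1 * w); last by rewrite mulVKg.
  by rewrite gmulfM multiplicativeV Fi wx mulVg.
have sat x : U x -> (f @^-1` (f @` U)) x by exists x.
have [B B1 BU] : exists2 B : set G', nbhs (1 : G') B & i @^-1` B `<=` U.
  by rewrite -(multiplicative1 i); exact: embedding_nbhs.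
split=> [|g].
- have : (fun p : G' * G' => p.1 ^ p.2^-1) @ (1 : G', 1 : G') -->
      (1^-1^-1 * (1 * 1^-1) : G').
    rewrite /conjg; apply: cvg_mulg.
      by do 2 apply: cvg_invg; exact: cvg_snd.
    by apply: cvg_mulg; [exact: cvg_fst | apply: cvg_invg; exact: cvg_snd].
  rewrite !invg1 !mulg1 => /(_ _ B1) [[C D] /= [C1 D1] CD].
  exists (F @` D); first exact: nbhsi.
  apply/thinE.
  have : nbhs (1 : G) (i @^-1` C).
    by apply: (embedding_continuous iemb); rewrite multiplicative1.
  apply: filterS => t Ct x [w Dw wx]; apply/sat/BU => /=.
  have [k Fk wE] := factor _ _ wx.
  have := CD (i t, w) (conj Ct Dw); rewrite /= wE.
  rewrite multiplicativeJ multiplicativeV invgM conjgM.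
  by rewrite [i t ^ k^-1]/conjg invgK mulgA -(comm _ _ Fk) mulgK.
- have : (fun w : G' => commutator (i g) w) @ (1 : G') -->
      i g * 1 * (i g)^-1 * 1^-1.
    rewrite /commutator; apply: cvg_mulg; last by apply: cvg_invg; exact: cvg_id.
    by apply: cvg_mulg; [apply: cvg_mulg; [exact: cvg_cst | exact: cvg_id] | exact: cvg_cst].
  rewrite mulg1 mulgV invg1 mulg1 => /(_ _ B1) D1.
  exists (F @` [set w | B (commutator (i g) w)]); first exact: nbhsi.
  move=> _ [x [w Bw wx] <-]; apply/sat/BU => /=.
  have [k Fk wE] := factor _ _ wx; move: Bw; rewrite /= wE multiplicative_commutator.
  rewrite /commutator invgM.
  have cV : k * (i g)^-1 = (i g)^-1 * k by rewrite (commuteV _) //; exact/commute_sym/comm.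
  by rewrite !mulgA -(mulgA _ k) cV mulgA mulgK.
Qed.

(** * Topological semidirect products *)

Record continuous_action (G H : topologicalGroupType) := ContinuousAction {
  act :> H -> G -> G;
  act1 : forall x, act 1 x = x;
  actM : forall h k x, act (h * k) x = act h (act k x);
  act_morph : forall h, {morph act h : x y / x * y};
  act_continuous : continuous (fun p : H * G => act p.1 p.2)
}.

(** A type of its own, because [prod] already carries the direct product group
    structure. *)
Definition semidirect (G H : topologicalGroupType) (a : continuous_action G H) : Type :=
  (G * H)%type.

Section SemidirectProduct.
Variables (G H : topologicalGroupType) (a : continuous_action G H).
Local Notation S := (semidirect a).

HB.instance Definition _ := Topological.copy S (G * H)%type.

Definition semidirect_one : S := (1, 1).
Definition semidirect_mul (p q : S) : S := (p.1 * a p.2 q.1, p.2 * q.2).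
Definition semidirect_inv (p : S) : S := (a p.2^-1 p.1^-1, p.2^-1).

Lemma act_one h : a h 1 = 1.
Proof. by apply: (mulgI (a h 1)); rewrite -act_morph !mulg1. Qed.

Lemma semidirect_mulA : associative semidirect_mul.
Proof.
by move=> p q r; rewrite /semidirect_mul /= act_morph actM !mulgA.
Qed.

Lemma semidirect_mul1 : left_id semidirect_one semidirect_mul.
Proof. by move=> [u h]; rewrite /semidirect_mul /= act1 !mul1g. Qed.

Lemma semidirect_mulr1 : right_id semidirect_one semidirect_mul.
Proof. by move=> [u h]; rewrite /semidirect_mul /= act_one !mulg1. Qed.

Lemma semidirect_mulV : left_inverse semidirect_one semidirect_inv semidirect_mul.
Proof.
by move=> [u h]; rewrite /semidirect_mul /= -act_morph !mulVg act_one.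
Qed.

Lemma semidirect_mulrV : right_inverse semidirect_one semidirect_inv semidirect_mul.
Proof.
by move=> [u h]; rewrite /semidirect_mul /= -actM !mulgV act1 mulgV.
Qed.

HB.instance Definition _ := isGroup.Build S semidirect_mulA semidirect_mul1
  semidirect_mulr1 semidirect_mulV semidirect_mulrV.

Lemma cvg_act (T : Type) (F : set_system T) (FF : Filter F) (u : T -> H) (v : T -> G) h x :
  u @ F --> h -> v @ F --> x -> (fun t => a (u t) (v t)) @ F --> a h x.
Proof.
move=> uh vx; apply: (@continuous2_cvg T H G G F FF u v (fun h x => a h x)) => //.
exact: (@act_continuous G H a (h, x)).
Qed.

Lemma semidirect_mul_continuous : continuous (fun p : S * S => p.1 * p.2).
Proof.
move=> [[u h] [v k]].
have c1 : (fun p : S * S => p.1) @ ((u, h) : S, (v, k) : S) --> ((u, h) : G * H).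
  exact: cvg_fst.
have c2 : (fun p : S * S => p.2) @ ((u, h) : S, (v, k) : S) --> ((v, k) : G * H).
  exact: cvg_snd.
have c11 := cvg_comp _ _ c1 (@fst_continuous _ _ (u, h)).
have c12 := cvg_comp _ _ c1 (@snd_continuous _ _ (u, h)).
have c21 := cvg_comp _ _ c2 (@fst_continuous _ _ (v, k)).
have c22 := cvg_comp _ _ c2 (@snd_continuous _ _ (v, k)).
apply: (@cvg_pair _ _ _ _ (nbhs (u * a h v)) (nbhs (h * k))).
  by apply: cvg_mulg => //; exact: cvg_act.
exact: cvg_mulg.
Qed.

Lemma semidirect_inv_continuous : continuous (fun p : S => p^-1).
Proof.
move=> [u h].
have c1 : (fun p : S => p.1) @ ((u, h) : S) --> u by exact: cvg_fst.
have c2 : (fun p : S => p.2) @ ((u, h) : S) --> h by exact: cvg_snd.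
apply: (@cvg_pair _ _ _ _ (nbhs (a h^-1 u^-1)) (nbhs h^-1)).
  by apply: cvg_act; exact: cvg_invg.
exact: cvg_invg.
Qed.

HB.instance Definition _ :=
  isTopologicalGroup.Build S semidirect_mul_continuous semidirect_inv_continuous.

Definition semidirect_inl (x : G) : S := (x, 1).

Lemma semidirect_inlM : {morph semidirect_inl : x y / x * y}.
Proof.
by move=> x y; rewrite [RHS]/mul /= /semidirect_mul /= act1 mulg1.
Qed.

HB.instance Definition _ := isMultiplicative.Build G S semidirect_inl semidirect_inlM.

Lemma semidirect_inl_embedding : topological_embedding semidirect_inl.
Proof.
split=> [x y []//|A]; split=> [oA|[B oB <-]].
- exists [set p : G * H | A p.1]; last by [].
  by have /continuousP := @fst_continuous G H; apply.
- have : continuous semidirect_inl.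
    by move=> x; apply: (@cvg_pair _ _ _ _ (nbhs x) (nbhs (1 : H)));
      [exact: cvg_id | exact: cvg_cst].
  by move=> /continuousP; apply.
Qed.

(** The range is the kernel of the second projection. *)
Lemma semidirect_inl_normal : is_normal_subgroup (range semidirect_inl).
Proof.
have snd_range (p : S) : p.2 = 1 -> range semidirect_inl p.
  by case: p => x h /= ->; exists x.
split=> [|_ _ [x _ <-] [y _ <-]|_ [x _ <-]|_ p [x _ <-]].
- exact: snd_range.
- by apply: snd_range; rewrite /= mulg1.
- by apply: snd_range; rewrite /= invg1.
- by apply: snd_range; rewrite /= mul1g mulVg.
Qed.

End SemidirectProduct.

(** * A-open isomorphisms are semitopological *)

(** The two clauses of A-openness are the continuity at (1, x), for every x, of the
    action of H on G by conjugation through the inverse [phi] of [f]: thinness is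
    continuity at (1, 1), and the commutator clause accounts for the factor
    phi(h) x phi(h)^-1 x^-1 in
    phi(h) y phi(h)^-1 = [phi(h), x] * x * phi(h) (x^-1 y) phi(h)^-1.
    A translation in H carries continuity at (1, x) to (h, x). *)
Lemma conj_act_continuous (G H : topologicalGroupType) (f : {multiplicative G -> H})
    (phi : {multiplicative H -> G}) :
  injective f -> cancel phi f -> A_open f ->
  continuous (fun p : H * G => p.2 ^ (phi p.1)^-1).
Proof.
move=> finj fK Af.
have satE U x : (f @^-1` (f @` U)) x -> U x by move=> [y Uy /finj <-].
pose act h x := x ^ (phi h)^-1; rewrite -/(act _ _).
have act1 x : act 1 x = x by rewrite /act multiplicative1 invg1 conjg1.
have act_cvg11 : (fun p : H * G => act p.1 p.2) @ (1 : H, 1 : G) --> act 1 1.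
  rewrite act1 => U /Af[[V V1 /thinE Vthin] _].
  exists (V, [set t | forall x, (f @^-1` V) x -> (f @^-1` (f @` U)) (t ^ x^-1)]) => //.
  by move=> [h t] /= [Vh tU]; apply: satE; apply: tU; rewrite /preimage /= fK.
have comm_cvg1 g : (fun h => commutator g (phi h)) @ (1 : H) --> (1 : G).
  move=> U /Af[_ /(_ g) [V V1 sV]]; apply: filterS V1 => h Vh.
  by apply: satE; apply: sV; exists (phi h); rewrite /preimage /= ?fK.
have act_cvg1 (x : G) : (fun p : H * G => act p.1 p.2) @ (1 : H, x) --> act 1 x.
  rewrite [X in X @ _ --> _](_ : _ = fun p : H * G =>
    (commutator x (phi p.1))^-1 * x * act p.1 (x^-1 * p.2)); last first.
    apply/funext => p; rewrite /act /conjg /commutator !invgM !invgK.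
    by rewrite !mulgA !mulgVK mulgK.
  have lim : (fun p : H * G => (commutator x (phi p.1))^-1 * x *
      act p.1 (x^-1 * p.2)) @ (1 : H, x) --> 1^-1 * x * act 1 1.
    have l1 : (fun p : H * G => p.1) @ (1 : H, x) --> (1 : H) by exact: cvg_fst.
    have l2 : (fun p : H * G => x^-1 * p.2) @ (1 : H, x) --> (1 : G).
      by rewrite -(mulVg x); apply: cvg_mulg; [exact: cvg_cst | exact: cvg_snd].
    apply: cvg_mulg.
      apply: cvg_mulg; last exact: cvg_cst.
      by apply: cvg_invg; exact: cvg_comp l1 (comm_cvg1 x).
    exact: (@continuous2_cvg _ H G G _ _ (fun p => p.1) (fun p => x^-1 * p.2) act).
  by move: lim; rewrite !act1 invg1 mul1g mulg1.
move=> [h x].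
have -> : (fun p : H * G => act p.1 p.2) = fun p => act h (act (h^-1 * p.1) p.2).
  by apply/funext => p; rewrite /act -conjgM -invgM -gmulfM mulVKg.
have l1 : (fun p : H * G => h^-1 * p.1) @ (h, x) --> (1 : H).
  by rewrite -(mulVg h); apply: cvg_mulg; [exact: cvg_cst | exact: cvg_fst].
have l2 : (fun p : H * G => p.2) @ (h, x) --> x by exact: cvg_snd.
have act_cvg (u : G) F (FF : Filter F) (v : H * G -> G) :
    v @ F --> u -> (fun p => act h (v p)) @ F --> act h u.
  rewrite /act /conjg => vu; apply: cvg_mulg; first exact: cvg_cst.
  by apply: cvg_mulg; last exact: cvg_cst.
rewrite /continuous_at mulVg.
apply: (act_cvg (act 1 x) _ _ (fun p => act (h^-1 * p.1) p.2)).
exact: (@continuous2_cvg _ H G G _ _ (fun p => h^-1 * p.1) (fun p => p.2) act).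
Qed.

(** The extension is (u, h) |-> f(u) h on the semidirect product of G by H. It is
    multiplicative because h acts by conjugation by an element above h, and it is
    open because its restriction to each slice {u} x H is a translation of H. *)
Lemma A_open_semitopological (G H : topologicalGroupType) (f : {multiplicative G -> H}) :
  continuous f -> injective f -> (forall y, exists x, f x = y) ->
  A_open f -> semitopological f.
Proof.
move=> fc finj fs Af; split=> //.
pose phi0 h := sval (cid (fs h)).
have fK0 : cancel phi0 f by move=> h; rewrite /phi0; case: cid.
have phi0M : {morph phi0 : h k / h * k} by move=> h k; apply: finj; rewrite gmulfM !fK0.
pose phi : {multiplicative H -> G} := HB.pack phi0 (isMultiplicative.Build _ _ phi0 phi0M).
have fK : cancel phi f := fK0.
pose act h x := x ^ (phi h)^-1.
have act1 x : act 1 x = x by rewrite /act multiplicative1 invg1 conjg1.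
have actM h k x : act (h * k) x = act h (act k x).
  by rewrite /act gmulfM invgM conjgM.
have act_morph h : {morph act h : x y / x * y} by move=> x y; exact: conjMg.
pose a := ContinuousAction act1 actM act_morph (conj_act_continuous finj fK Af).
pose F (p : semidirect a) := f p.1 * p.2.
have FM : {morph F : p q / p * q}.
  move=> [u h] [v k]; rewrite /F /= gmulfM /act multiplicativeJ multiplicativeV fK.
  by rewrite /conjg invgK !mulgA mulgVK.
pose Fm : {multiplicative semidirect a -> H} := HB.pack F (isMultiplicative.Build _ _ F FM).
exists (semidirect a), (semidirect_inl a), Fm; split.
- exact: semidirect_inl_embedding.
- exact: semidirect_inl_normal.
- move=> [u h]; apply: cvg_mulg; last exact: snd_continuous.
  by apply: cvg_comp; [exact: fst_continuous | exact: fc].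
- move=> A oA.
  rewrite [X in open X](_ : _ = \bigcup_x ((fun y => (x, (f x)^-1 * y)) @^-1` A)).
    apply: bigcup_open => x _.
    have c : continuous (fun y : H => (x, (f x)^-1 * y)).
      move=> y; apply: (@cvg_pair _ _ _ _ (nbhs x) (nbhs ((f x)^-1 * y))).
        exact: cvg_cst.
      exact: mulgl_continuous.
    by move/continuousP: c; apply.
  apply/seteqP; split=> [_ [[x h] Axh <-]|y [x _ Axy]].
    by exists x => //=; rewrite /F /= mulKg.
  by exists (x, (f x)^-1 * y); rewrite //= /F /= mulVKg.
- by move=> x; rewrite /= /F /= mulg1.
Qed.

(** * A-openness and the induced isomorphism *)

Theorem corollary6p5 (G H : topologicalGroupType) (f : {multiplicative G -> H})
    (f_continuous : continuous f) (f_surjective : forall y : H, exists x : G, f x = y)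
    (f' : {multiplicative quotient_group (kernel f) -> H})
    (f'E : forall g : G, f' (quotient_proj (kernel f) g) = f g) :
  A_open f <-> semitopological f'.
Proof.
have f'_lift : (f' : _ -> _) = @kernel_lift G H f.
  apply/funext => u; have [x <-] := quotient_proj_surj u.
  by rewrite f'E kernel_liftE.
have f'_inj : injective f' by rewrite f'_lift; exact: kernel_lift_inj.
have f'_surj : forall y, exists u, f' u = y by rewrite f'_lift; exact: kernel_lift_surj.
have f'_cont : continuous f' by rewrite f'_lift; exact: kernel_lift_continuous.
apply: iff_trans (A_open_comp (q := quotient_proj (kernel f)) _ _ _ f'E) _.
- exact: quotient_proj_continuous.
- by move=> A; exact: quotient_proj_open.
- exact: quotient_proj_surj.
- split; [exact: A_open_semitopological | exact: semitopological_A_open].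
Qed.
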